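(* For each discriminator clone $\mathcal{C}$ on a finite set $A$, the equivalence relation $\equiv_{\mathcal{C}}$ has finite index in $\mathcal{O}_A$ (that is, there are only finitely many $\mathcal{C}$-equivalence classes of operations on $A$).
   Context: For a nonempty set $A$ and an integer $n\ge1$, an $n$-ary operation on $A$ is a function $A^n\to A$; $\mathcal{O}_A^{(n)}$ is the set of all $n$-ary operations and $\mathcal{O}_A=\bigcup_{n\ge1}\mathcal{O}_A^{(n)}$. The projections are $p_i^{(n)}(a_1,\dots,a_n)=a_i$ ($1\le i\le n$). An $m$-tuple $\mathbf{h}=(h_1,\dots,h_m)$ of $n$-ary operations is identified with the function $\mathbf{h}\colon A^n\to A^m$, and for $g\in\mathcal{O}_A^{(m)}$, $g\circ\mathbf{h}=g(h_1,\dots,h_m)\in\mathcal{O}_A^{(n)}$. A clone on $A$ is a set $\mathcal{C}\subseteq\mathcal{O}_A$ containing all projections and closed under composition: $g\circ\mathbf{h}\in\mathcal{C}$ whenever $g\in\mathcal{C}$ is $m$-ary and $\mathbf{h}$ is an $m$-tuple of $n$-ary members of $\mathcal{C}$. $\mathcal{C}^{(n)}$ is the set of $n$-ary members of $\mathcal{C}$. For a clone $\mathcal{C}$ on $A$, $f\in\mathcal{O}_A^{(n)}$ and $g\in\mathcal{O}_A^{(m)}$: $f\leq_{\mathcal{C}}g$ if $f=g\circ\mathbf{h}$ for some $\mathbf{h}\in(\mathcal{C}^{(n)})^m$; $f$ and $g$ are $\mathcal{C}$-equivalent, written $f\equiv_{\mathcal{C}}g$, if $f\leq_{\mathcal{C}}g$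 and $g\leq_{\mathcal{C}}f$. The discriminator function on $A$ is the ternary operation $t$ with $t(x,y,z)=z$ if $x=y$ and $t(x,y,z)=x$ otherwise. A discriminator clone on $A$ is a clone on $A$ that contains $t$. *)

(* Defs.v *)
From mathcomp Require Import all_boot.
From mathcomp Require Import boolp classical_sets functions cardinality.

Set Implicit Arguments.
Unset Strict Implicit.
Unset Printing Implicit Defensive.

Local Open Scope classical_set_scope.

Definition nary (A : finType) (n : nat) : Type := {ffun n.-tuple A -> A}.

(* Operations of all arities; the arity is the tag.  Nullary functions inhabit
   this type too, and are excluded by [all_operations]. *)
Definition operation (A : finType) : Type := {n : nat & nary A n}.

Definition op (A : finType) (n : nat) (f : nary A n) : operation A :=
  Tagged (nary A) f.

Definition all_operations (A : finType) : set (operation A) :=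
  [set f | (0 < tag f)%N].
Arguments all_operations : clear implicits.

Definition proj (A : finType) (n : nat) (i : 'I_n) : nary A n :=
  [ffun a : n.-tuple A => tnth a i].

Definition compose (A : finType) (m n : nat) (g : nary A m)
    (h : m.-tuple (nary A n)) : nary A n :=
  [ffun a : n.-tuple A => g [tuple tnth h i a | i < m]].

(* The condition 1 <= n is implicit in [i : 'I_n] in [clone_proj], and
   the conditions 1 <= m, 1 <= n follow from [clone_sub] in [clone_compose]. *)
Record is_clone (A : finType) (C : set (operation A)) : Prop := IsClone {
  clone_sub : C `<=` all_operations A;
  clone_proj : forall (n : nat) (i : 'I_n), C (op (proj A i));
  clone_compose : forall (m n : nat) (g : nary A m) (h : m.-tuple (nary A n)),
    C (op g) -> (forall i : 'I_m, C (op (tnth h i))) -> C (op (compose g h))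
}.

Definition clone_le (A : finType) (C : set (operation A))
    (f g : operation A) : Prop :=
  exists h : (tag g).-tuple (nary A (tag f)),
    (forall i : 'I_(tag g), C (op (tnth h i))) /\
    tagged f = compose (tagged g) h.

Definition clone_equiv (A : finType) (C : set (operation A))
    (f g : operation A) : Prop :=
  clone_le C f g /\ clone_le C g f.

Definition discriminator (A : finType) : nary A 3 :=
  [ffun a : 3.-tuple A =>
     let x := tnth a (@Ordinal 3 0 isT) in
     let y := tnth a (@Ordinal 3 1 isT) in
     let z := tnth a (@Ordinal 3 2 isT) in
     if x == y then z else x].

Definition is_discriminator_clone (A : finType) (C : set (operation A)) : Prop :=
  is_clone C /\ C (op (discriminator A)).

Definition equiv_class (T : Type) (D : set T) (E : T -> T -> Prop) (x : T) :
    set T :=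
  [set y | D y /\ E x y].

Definition has_finite_index (T : Type) (D : set T) (E : T -> T -> Prop) : Prop :=
  finite_set [set equiv_class D E x | x in D].

(* Main.v *)
Require Import Defs.
From mathcomp Require Import all_boot.
From mathcomp Require Import boolp classical_sets functions cardinality.

(** Let [C] be a discriminator clone.  The switching function
    [if x = y then z else w] is a composition of discriminators, so [C]
    contains every operation that returns one of its arguments, at an index
    depending only on which arguments are equal ([clone_select]).

    To an operation [f] of arity [n] attach the set [invariant f] of all pairs
    [(B, s |-> f (s a))], where [a] ranges over the [n]-tuples with entries in
    [B] and [s] over the maps from [A] to [A], acting entrywise.  The invariant
    takes its values in a fixed finite type, whatever the arity of [f].

    If [invariant f] is included in [invariant g], then [f] lies below [g] for
    [clone_le C] ([clone_le_invariant]).  Indeed each tuple [a] admits a tuple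
    [b], whose entries are entries of [a], with [f (s a) = g (s b)] for every
    [s].  Fix one [a] for each equality pattern and write [b] as a selection
    of entries of [a].  A tuple with the same pattern as [a] has the form
    [s a], so making that same selection on all tuples with this pattern
    expresses [f] as [g] composed with operations of the kind above.  Hence
    operations with equal invariants are equivalent, and there are at most as
    many classes as values of the invariant. *)

Set Implicit Arguments.
Unset Strict Implicit.
Unset Printing Implicit Defensive.

(** The truth values of the equalities between entries of [a] listed in [P]. *)
Definition eq_pattern (A : finType) (n : nat) (P : seq ('I_n * 'I_n))
    (a : n.-tuple A) : seq bool :=
  [seq tnth a p.1 == tnth a p.2 | p <- P].

(** The operation returning the argument whose index [d] assigns to the pattern
    of equalities among the arguments. *)
Definition select (A : finType) (n : nat) (P : seq ('I_n * 'I_n))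
    (d : seq bool -> 'I_n) : nary A n :=
  [ffun a : n.-tuple A => tnth a (d (eq_pattern P a))].

(** The second component of a member records the values of [f] at all images
    of a tuple [a]; the first is any set containing the entries of [a]. *)
Definition invariant (A : finType) (f : operation A) :
    {set {set A} * {ffun {ffun A -> A} -> A}} :=
  [set p : {set A} * {ffun {ffun A -> A} -> A} |
   [exists a : (tag f).-tuple A,
     [forall i, tnth a i \in p.1] &&
     (p.2 == [ffun s : {ffun A -> A} => tagged f (map_tuple s a)])]].

Lemma composeA (A : finType) (k m n : nat) (f : nary A k)
    (g : k.-tuple (nary A m)) (h : m.-tuple (nary A n)) :
  compose (compose f g) h = compose f [tuple compose (tnth g i) h | i < k].
Proof.
apply/ffunP => a; rewrite !ffunE; congr (f _).
by apply: eq_from_tnth => i; rewrite !tnth_mktuple ffunE.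
Qed.

Lemma clone_le_trans (A : finType) (C : set (operation A)) :
  is_clone C ->
  forall f g k, clone_le C f g -> clone_le C g k -> clone_le C f k.
Proof.
move=> hC f g k [h [hh fE]] [l [hl gE]].
exists [tuple compose (tnth l i) h | i < tag k]; split.
  by move=> i; rewrite tnth_mktuple; exact: (clone_compose hC).
by rewrite fE gE composeA.
Qed.

Lemma clone_equiv_sym (A : finType) (C : set (operation A)) f g :
  clone_equiv C f g -> clone_equiv C g f.
Proof. by case. Qed.

Lemma clone_equiv_trans (A : finType) (C : set (operation A)) :
  is_clone C ->
  forall f g k, clone_equiv C f g -> clone_equiv C g k -> clone_equiv C f k.
Proof.
move=> hC f g k [fg gf] [gk kg].
by split; [exact: clone_le_trans fg gk|exact: clone_le_trans kg gf].
Qed.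

Lemma clone_discriminator (A : finType) (C : set (operation A)) (n : nat)
    (p q u : nary A n) :
  is_discriminator_clone C -> C (op p) -> C (op q) -> C (op u) ->
  C (op [ffun a : n.-tuple A => if p a == q a then u a else p a]).
Proof.
move=> [hC hd] hp hq hu.
have -> : [ffun a : n.-tuple A => if p a == q a then u a else p a] =
          compose (discriminator A) [tuple p; q; u].
  by apply/ffunP => a; rewrite !ffunE !tnth_mktuple.
by apply: (clone_compose hC hd) => -[[|[|[|]]]].
Qed.

Lemma clone_switch (A : finType) (C : set (operation A)) (n : nat)
    (p q u v : nary A n) :
  is_discriminator_clone C ->
  C (op p) -> C (op q) -> C (op u) -> C (op v) ->
  C (op [ffun a : n.-tuple A => if p a == q a then u a else v a]).
Proof.
move=> hC hp hq hu hv.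
(* With [t] the discriminator, this is [t (t p q u) (t p q v) v]. *)
have := clone_discriminator hC (clone_discriminator hC hp hq hu)
          (clone_discriminator hC hp hq hv) hv.
congr (C (op _)); apply/ffunP => a; rewrite !ffunE.
by case: (p a == q a); [case: eqP|rewrite eqxx].
Qed.

Lemma clone_select (A : finType) (C : set (operation A)) (n : nat)
    (P : seq ('I_n * 'I_n)) (d : seq bool -> 'I_n) :
  is_discriminator_clone C -> C (op (select A P d)).
Proof.
move=> hC; elim: P d => [|[i j] P IHP] d.
  have -> : select A [::] d = proj A (d [::]) by apply/ffunP => a; rewrite !ffunE.
  exact: clone_proj hC.1 _ _.
have := clone_switch hC (clone_proj hC.1 i) (clone_proj hC.1 j)
  (IHP (fun v => d (true :: v))) (IHP (fun v => d (false :: v))).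
congr (C (op _)); apply/ffunP => a; rewrite !ffunE /=.
by case: (tnth a i == tnth a j).
Qed.

Lemma eq_pattern_map (A : finType) (n : nat) (a b : n.-tuple A) :
  eq_pattern (enum {: 'I_n * 'I_n}) a = eq_pattern (enum {: 'I_n * 'I_n}) b ->
  exists s : {ffun A -> A}, b = map_tuple s a.
Proof.
move=> /eq_in_map eq_ab.
exists [ffun x => if [pick i | tnth a i == x] is Some i then tnth b i else x].
apply: eq_from_tnth => i; rewrite tnth_map ffunE.
case: pickP => [j /eqP aji|/(_ i)]; last by rewrite eqxx.
have := eq_ab (j, i); rewrite mem_enum /= aji eqxx => /(_ isT) /esym /eqP.
by [].
Qed.

Lemma invariant_sub_select (A : finType) (f g : operation A) :
  invariant f \subset invariant g ->
  forall a : (tag f).-tuple A, exists I : 'I_(tag g) -> 'I_(tag f),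
    forall s : {ffun A -> A},
      tagged f (map_tuple s a) = tagged g [tuple s (tnth a (I k)) | k < tag g].
Proof.
move=> /fintype.subsetP fg a.
pose p := ([set x in a], [ffun s : {ffun A -> A} => tagged f (map_tuple s a)]).
have /fg : p \in invariant f.
  rewrite inE; apply/existsP; exists a; rewrite eqxx andbT.
  by apply/forallP => i; rewrite inE mem_tnth.
rewrite inE => /existsP[b /andP[/forallP ba /eqP fgab]].
have /boolp.choice[I bI] (k : 'I_(tag g)) : exists i, tnth b k = tnth a i.
  by have := ba k; rewrite inE => /tnthP[i ->]; exists i.
exists I => s; have /ffunP/(_ s) := fgab; rewrite !ffunE => ->.
congr (tagged g _); apply: eq_from_tnth => k.
by rewrite tnth_map tnth_mktuple bI.
Qed.

Lemma clone_le_invariant (A : finType) (C : set (operation A))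
    (f g : operation A) :
  is_discriminator_clone C -> 0 < tag f ->
  invariant f \subset invariant g -> clone_le C f g.
Proof.
move=> hC f_gt0 /invariant_sub_select/boolp.choice[I fgI].
pose pattern := @eq_pattern A (tag f) (enum {: 'I_(tag f) * 'I_(tag f)}).
(* The selection for a pattern is read off one chosen tuple realizing it; a
   pattern that no tuple realizes gets the irrelevant index 0. *)
pose d k v := if [pick a | pattern a == v] is Some a then I a k
              else Ordinal f_gt0.
exists [tuple select A (enum {: 'I_(tag f) * 'I_(tag f)}) (d k) | k < tag g].
split=> [k|]; first by rewrite tnth_mktuple; exact: clone_select.
apply/ffunP => b; rewrite ffunE.
have [a ab da] : exists2 a, pattern a = pattern b &
    forall k, d k (pattern b) = I a k.
  rewrite /d; case: pickP => [a /eqP ab|/(_ b)]; last by rewrite eqxx.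
  by exists a.
have [s bE] := eq_pattern_map ab.
rewrite {1}bE fgI; congr (tagged g _); apply: eq_from_tnth => k.
by rewrite !tnth_mktuple ffunE -/(pattern b) da bE tnth_map.
Qed.

Lemma has_finite_index_invariant (T : Type) (F : finType)
    (D : set T) (E : T -> T -> Prop) (S : T -> F) :
  (forall x y, E x y -> E y x) ->
  (forall x y z, E x y -> E y z -> E x z) ->
  (forall x y, D x -> D y -> S x = S y -> E x y) ->
  has_finite_index D E.
Proof.
move=> Esym Etrans SE.
(* The class of [x] is recovered from [S x] as the union of the classes of all
   points of [D] where [S] takes this value. *)
pose K v := [set y | exists x, [/\ D x, S x = v & Defs.equiv_class D E x y]]%classic.
have finK : finite_set (K @` [set: F])%classic.
  by apply: finite_image; exact: finite_finset.
apply: sub_finite_set finK => _ [x Dx <-]; exists (S x) => //.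
apply/seteqP; split=> [y [z [Dz Szx [Dy Ezy]]]|y xy]; last by exists x.
by split=> //; apply: Etrans Ezy; apply: SE.
Qed.

Theorem corollary4p2 (A : finType) (hA : (0 < #|A|)%N)
    (C : set (operation A)) (hC : is_discriminator_clone C) :
  has_finite_index (all_operations A) (clone_equiv C).
Proof.
apply: (@has_finite_index_invariant _ _ _ _ (@invariant A)).
- exact: clone_equiv_sym.
- exact: clone_equiv_trans hC.1.
- by move=> f g Df Dg fg; split; apply: clone_le_invariant => //; rewrite fg.
Qed.
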